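(* Let $A \geq 2$ and $B, C \geq 0$ be integers, and for integers $n \geq 0$ define \[ \mathcal{S}(n; A, B, C) = \sum_{k=0}^{n} \binom{n}{k}^A \binom{n+k}{k}^B \binom{2k}{n}^C . \] Then for all integers $m \geq 1$, $r \geq 1$ and all primes $p \geq 5$, \[ \mathcal{S}(m p^r; A, B, C) \equiv \mathcal{S}(m p^{r-1}; A, B, C) \pmod{p^{3r}}. \]
   Context: Binomial coefficients $\binom{a}{b}$ with $0\le a<b$ are $0$. *)

(* Defs.v *)
From mathcomp Require Import all_boot.

Set Implicit Arguments.
Unset Strict Implicit.
Unset Printing Implicit Defensive.

(* 'C(a, b) = 0 for a < b; zeroth powers are 1, including 0 ^ 0 (this matters
   when C = 0 and 2 * k < n). *)
Definition calS (n A B C : nat) : nat :=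
  \sum_(0 <= k < n.+1) 'C(n, k) ^ A * 'C(n + k, k) ^ B * 'C(2 * k, n) ^ C.

(* Main.v *)
Require Import Defs.
From mathcomp Require Import all_boot.
From mathcomp Require Import all_algebra all_solvable zify ring.

(* If p does not divide k, then k C(n,k) = n C(n-1,k-1) puts p^(2r) in front of
   the k-th summand, and for A = 2 it remains to see that the sum of
   k^(-2) G_n(2k) vanishes modulo p^r, where G_n(2k) is the remaining product of
   binomials. Modulo p^r, G_n(j) = G_(n/p)(floor(j/p)); hence, passing from
   level i to level i+1, the weight depends only on q = floor(2k/p^i) up to an
   error divisible by p^(r-i) that also depends only on q, and the sum of k^(-2)
   over the k prime to p in such a half-block is divisible by p^i (symmetry
   k -> -k, and k -> 2k, which is where p >= 5 enters).

   If p divides k, let p^t = gcd(k, p^r). A Jacobsthal-type congruence shows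
   that the three binomials for (n, k) and (n/p, k/p) agree modulo p^(r+2t) up
   to the common factor p^(r-t) of C(n,k) and C(n/p,k/p); as A >= 2, this
   factor supplies the missing p^(2(r-t)). *)

Set Implicit Arguments.
Unset Strict Implicit.
Unset Printing Implicit Defensive.

(** * Congruences between natural numbers *)

Lemma eqn_modM d a b c e :
  a = b %[mod d] -> c = e %[mod d] -> a * c = b * e %[mod d].
Proof. by move=> h1 h2; rewrite -modnMm h1 h2 modnMm. Qed.

Lemma eqn_modX d a b c : a = b %[mod d] -> a ^ c = b ^ c %[mod d].
Proof. by move=> h; rewrite -modnXm h modnXm. Qed.

Lemma eqn_mod_dvdl e d a b : d %| e -> a = b %[mod e] -> a = b %[mod d].
Proof. by move=> de h; rewrite -(modn_dvdm a de) h modn_dvdm. Qed.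

Lemma eqn_mod_scale d e a b h :
  a = b %[mod d] -> e %| h -> a * h = b * h %[mod d * e].
Proof. by move=> ab /dvdnP[c ->]; rewrite !mulnA -!muln_modl (eqn_modM ab (erefl (c %% d))). Qed.

Lemma eqn_mod_sum d (I : Type) (s : seq I) (P : pred I) (F G : I -> nat) :
  (forall i, P i -> F i = G i %[mod d]) ->
  \sum_(i <- s | P i) F i = \sum_(i <- s | P i) G i %[mod d].
Proof.
move=> FG; elim/big_rec2: _ => // i x y Pi xy.
by rewrite -modnDm (FG i Pi) xy modnDm.
Qed.

Lemma eqn_mod_prod d (I : Type) (s : seq I) (P : pred I) (F G : I -> nat) :
  (forall i, P i -> F i = G i %[mod d]) ->
  \prod_(i <- s | P i) F i = \prod_(i <- s | P i) G i %[mod d].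
Proof.
move=> FG; elim/big_rec2: _ => // i x y Pi xy.
exact: eqn_modM (FG i Pi) xy.
Qed.

Lemma eqn_mod_cancel d u a b :
  coprime d u -> a * u = b * u %[mod d] -> a = b %[mod d].
Proof.
move=> cdu; wlog ab : a b / b <= a => [hw e|/eqP].
  by case/orP: (leq_total b a) => h; [|symmetry]; apply: hw.
rewrite eqn_mod_dvd ?leq_mul2r ?ab ?orbT // -mulnBl Gauss_dvdl // => h.
by apply/eqP; rewrite eqn_mod_dvd.
Qed.

Lemma Zp_nat_eqP N a b : 1 < N -> (a%:R = b%:R :> 'Z_N)%R <-> a = b %[mod N].
Proof.
move=> N1; split=> [/(congr1 val)/=|h]; first by rewrite !val_Zp_nat.
by apply: val_inj; rewrite /= !val_Zp_nat.
Qed.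

(** * Binomial coefficients modulo p^r and division of their arguments by p *)

Definition prod_cop (p x k : nat) : nat :=
  \prod_(1 <= j < k.+1 | ~~ (p %| j)) (x + j).

Lemma prod_copS p x k : prod_cop p x k.+1 =
  if p %| k.+1 then prod_cop p x k else prod_cop p x k * (x + k.+1).
Proof.
rewrite /prod_cop (big_mkcond (fun j => ~~ _)) big_nat_recr //= -big_mkcond.
by case: (p %| k.+1); rewrite /= ?muln1.
Qed.

Lemma prod_cop_coprime p k n : prime p -> coprime (p ^ n) (prod_cop p 0 k).
Proof.
move=> pp; apply: coprimeXl; rewrite prime_coprime //.
elim: k => [|k IH]; first by rewrite /prod_cop big_geq // dvdn1 neq_ltn prime_gt1 ?orbT.
by rewrite prod_copS; case: ifP => // h; rewrite Euclid_dvdM // negb_or IH h.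
Qed.

(** In C(pa + k, k) the multiples of p among the factors pa + 1, ..., pa + k and 1, ..., k are p(a +
    i) and pi. Their quotients form the smaller binomial, and [prod_cop] collects the other
    factors. *)
Lemma bin_prod_cop p a k : 0 < p ->
  'C(p * a + k, k) * prod_cop p 0 k = 'C(a + k %/ p, k %/ p) * prod_cop p (p * a) k.
Proof.
move=> p0; elim: k => [|k IH].
  by rewrite div0n !bin0 /prod_cop !big_geq.
have e1 : (p * a + k.+1) * 'C(p * a + k, k) = k.+1 * 'C(p * a + k.+1, k.+1).
  by rewrite addnS -mul_bin_diag.
apply/eqP; rewrite -(eqn_pmul2l (ltn0Sn k)); apply/eqP; rewrite mulnA -e1.
rewrite !prod_copS divnS //; case: ifP => [h|_] /=; last first.
  transitivity ((p * a + k.+1) * k.+1 * ('C(p * a + k, k) * prod_cop p 0 k)).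
    ring.
  rewrite IH add0n; ring.
have e2 : (a + (k %/ p).+1) * 'C(a + k %/ p, k %/ p)
          = (k %/ p).+1 * 'C(a + (k %/ p).+1, (k %/ p).+1).
  by rewrite addnS -mul_bin_diag.
have ek : k.+1 = p * (k %/ p).+1 by rewrite -{1}(divnK h) divnS // h mulnC.
rewrite add1n -mulnA IH.
transitivity (p * ((a + (k %/ p).+1) * 'C(a + k %/ p, k %/ p)) * prod_cop p (p * a) k).
  rewrite ek; ring.
rewrite e2 ek; ring.
Qed.

(** As n vanishes modulo p^r, both [prod_cop] factors become the same unit, which cancels. *)
Lemma bin_add_mod_floor p r n k : prime p -> p ^ r %| n -> 0 < r ->
  'C(n + k, k) = 'C(n %/ p + k %/ p, k %/ p) %[mod p ^ r].
Proof.
move=> pp prn r0; have p0 := prime_gt0 pp.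
have pn : p %| n by apply: dvdn_trans prn; apply: dvdn_exp.
apply: (eqn_mod_cancel (prod_cop_coprime k r pp)).
have := bin_prod_cop (n %/ p) k p0; rewrite [p * _]mulnC divnK // => ->.
apply: eqn_modM => //; apply: eqn_mod_prod => j _.
by rewrite add0n -modnDml (eqP prn).
Qed.

Lemma bin_mod_floor p r n j : prime p -> p ^ r %| n -> 0 < r ->
  'C(j, n) = 'C(j %/ p, n %/ p) %[mod p ^ r].
Proof.
move=> pp prn r0; have p0 := prime_gt0 pp.
have pn : p %| n by apply: dvdn_trans prn; apply: dvdn_exp.
have [jn|nj] := ltnP j n.
  by rewrite !bin_small // ltn_divLR // divnK.
have e : j = n + (j - n) by rewrite subnKC.
have e2 : j %/ p = n %/ p + (j - n) %/ p by rewrite {1}e divnDl.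
have := bin_add_mod_floor (j - n) pp prn r0.
rewrite -e -e2 bin_sub // => ->.
by have := bin_sub (leq_addr ((j - n) %/ p) (n %/ p)); rewrite addKn e2 => ->.
Qed.

Lemma bin_pred_prod_cop p n k : 0 < p -> p %| n ->
  'C(n.-1, k) * prod_cop p 0 k =
  'C((n %/ p).-1, k %/ p) * \prod_(1 <= j < k.+1 | ~~ (p %| j)) (n - j).
Proof.
move=> p0 pn; elim: k => [|k IH].
  by rewrite div0n !bin0 /prod_cop !big_geq.
apply/eqP; rewrite -(eqn_pmul2l (ltn0Sn k)) mulnA mul_bin_left; apply/eqP.
rewrite (big_mkcond (fun j => ~~ _)) big_nat_recr //= -big_mkcond.
have -> : n.-1 - k = n - k.+1 by lia.
rewrite !prod_copS divnS //; case: ifP => [h|_] /=; last first.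
  transitivity ((n - k.+1) * k.+1 * ('C(n.-1, k) * prod_cop p 0 k)).
    ring.
  rewrite IH add0n; ring.
have ek : k.+1 = p * (k %/ p).+1 by rewrite -{1}(divnK h) divnS // h mulnC.
rewrite add1n -mulnA IH muln1 [RHS]mulnA ek -[p * _ * _]mulnA mul_bin_left.
have -> : n - p * (k %/ p).+1 = p * ((n %/ p).-1 - k %/ p).
  by rewrite -{1}(divnK pn) mulnC -mulnBr -[in RHS]subn1 -subnDA add1n.
by rewrite !mulnA.
Qed.

(** Each factor n - j is congruent to -j; squaring removes the signs. *)
Lemma bin_pred_sqr_mod_floor p r n k : prime p -> p ^ r %| n -> 0 < r -> 0 < n ->
  'C(n.-1, k) ^ 2 = 'C((n %/ p).-1, k %/ p) ^ 2 %[mod p ^ r].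
Proof.
move=> pp prn r0 n0; have p0 := prime_gt0 pp.
have pn : p %| n by apply: dvdn_trans prn; apply: dvdn_exp.
have [nk|kn] := leqP n k.
  have h : n %/ p <= k %/ p by rewrite leq_div2r.
  have h0 : 0 < n %/ p by rewrite divn_gt0 // dvdn_leq.
  by rewrite !bin_small //; lia.
have c := prod_cop_coprime k r pp.
apply: (@eqn_mod_cancel _ (prod_cop p 0 k ^ 2)); first exact: coprimeXr.
rewrite -expnMn bin_pred_prod_cop // expnMn; apply: eqn_modM => //.
rewrite -!mulnn /prod_cop -!big_split /=.
rewrite big_nat_cond [in RHS]big_nat_cond; apply: eqn_mod_prod => j /andP[/andP[j1 jk] _].
rewrite add0n; have jn : j <= n by lia.
(* Adding (n - j) j turns (n - j)^2 and j^2 into the multiples (n - j) n and n j of n. *)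
apply/eqP; rewrite -(eqn_modDr ((n - j) * j)) -mulnDr -mulnDl subnK // subnKC //.
by rewrite (eqP (dvdn_mull _ prn)) (eqP (dvdn_mulr _ prn)).
Qed.

(** * Sums of inverse squares over blocks and half-blocks *)

(** The weight [w] stands for k^(-2). Its values are natural numbers, so that one [w] serves for all
    moduli dividing [M]. *)
Definition inv_sqr_mod (p M : nat) (w : nat -> nat) : Prop :=
  forall k, ~~ (p %| k) -> k ^ 2 * w k = 1 %[mod M].

Lemma inv_sqr_mod_exists p r : prime p -> exists w, inv_sqr_mod p (p ^ r) w.
Proof.
move=> pp; exists (fun k => (k ^ (totient (p ^ r)).-1) ^ 2) => k pk.
have t0 : 0 < totient (p ^ r) by rewrite totient_gt0 expn_gt0 prime_gt0.
rewrite -expnMn -expnS prednK // -[in RHS](exp1n 2); apply: eqn_modX.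
by apply: Euler_exp_totient; rewrite coprime_sym coprimeXl // prime_coprime.
Qed.

Section HalfSums.
Local Open Scope ring_scope.
Import GRing.Theory.

Lemma unit_Zp_primeX p i k : prime p -> (0 < i)%N ->
  (k%:R \is a @GRing.unit 'Z_(p ^ i)) = ~~ (p %| k)%N.
Proof.
move=> pp i0; rewrite unitZpE; last by rewrite -(exp1n i) ltn_exp2r // prime_gt1.
by rewrite coprime_pexpl // prime_coprime.
Qed.

Lemma inv_sqr_modE p i w t : prime p -> (0 < i)%N -> inv_sqr_mod p (p ^ i) w ->
  ~~ (p %| t)%N -> (w t)%:R = (t%:R ^- 2) :> 'Z_(p ^ i).
Proof.
move=> pp i0 hw pt.
have N1 : (1 < p ^ i)%N by rewrite -(exp1n i) ltn_exp2r // prime_gt1.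
have ut : (t%:R : 'Z_(p ^ i)) \is a GRing.unit by rewrite unit_Zp_primeX.
have := hw t pt => /(Zp_nat_eqP _ _ N1); rewrite natrM natrX => h.
apply: (mulrI (unitrX 2 ut)).
by rewrite h mulrV ?unitrX.
Qed.

Lemma natr_unit_Zp p i c : prime p -> (0 < i)%N -> (0 < c < p)%N ->
  (c%:R : 'Z_(p ^ i)) \is a GRing.unit.
Proof.
move=> pp i0 /andP[c0 cp]; rewrite unit_Zp_primeX //.
by apply/negP => /(dvdn_leq c0); rewrite leqNgt cp.
Qed.

(* The sum over all units is multiplied by 1/4 under x -> 2x. *)
Lemma sum_inv_sqr_Zp p i : prime p -> (5 <= p)%N -> (0 < i)%N ->
  \sum_(x : 'Z_(p ^ i) | x \is a GRing.unit) x ^- 2 = 0.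
Proof.
move=> pp p5 i0; set S := \sum_(x | _) _.
have u2 : (2%:R : 'Z_(p ^ i)) \is a GRing.unit by apply: natr_unit_Zp => //; lia.
have u3 : (3%:R : 'Z_(p ^ i)) \is a GRing.unit by apply: natr_unit_Zp => //; lia.
have e : S = S * 2%:R ^- 2.
  rewrite {1}/S (reindex_inj (mulIr u2)) /= mulr_suml.
  apply: eq_big => x; rewrite unitrMl // => ux.
  by rewrite exprMn invrM ?unitrX // mulrC.
(* From 4 S = S follows 3 S = 0, and 3 is a unit. *)
have : S * 3%:R = 0.
  have : S * 2%:R ^+ 2 = S by rewrite {1}e divrK // unitrX.
  rewrite -[RHS]mulr1 => /eqP; rewrite -subr_eq0 -mulrBr => /eqP <-; congr (_ * _).
  by ring.
by move/(congr1 (fun x => x / 3%:R)); rewrite mulrK // mul0r.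
Qed.

Lemma sum_inv_sqr_mod p i w : prime p -> (5 <= p)%N -> (0 < i)%N ->
  inv_sqr_mod p (p ^ i) w ->
  (\sum_(0 <= t < p ^ i | ~~ (p %| t)%N) (w t)%:R : 'Z_(p ^ i)) = 0.
Proof.
move=> pp p5 i0 hw.
have N1 : (1 < p ^ i)%N by rewrite -(exp1n i) ltn_exp2r // prime_gt1.
rewrite -[RHS](sum_inv_sqr_Zp pp p5 i0) -[X in \sum_(0 <= _ < X | _) _](Zp_cast N1) big_mkord.
apply: eq_big => [x|x px]; first by rewrite -[in RHS](natr_Zp x) unit_Zp_primeX.
by rewrite (inv_sqr_modE pp i0 hw px) natr_Zp.
Qed.

(** The reflection t -> P - t exchanges the two halves (P is odd, so 2t = P never occurs) and
    preserves t^(-2). The half-sums are thus equal with sum 0, and 2 is a unit. *)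
Lemma half_sum_inv_sqr_mod p i w (P := (p ^ i)%N) :
  prime p -> (5 <= p)%N -> (0 < i)%N -> inv_sqr_mod p P w ->
  (P %| \sum_(0 <= t < P | ~~ (p %| t)%N && (2 * t < P)%N) w t)%N /\
  (P %| \sum_(0 <= t < P | ~~ (p %| t)%N && ~~ (2 * t < P)%N) w t)%N.
Proof.
move=> pp p5 i0 hw.
have P1 : (1 < P)%N by rewrite -(exp1n i) ltn_exp2r // prime_gt1.
have pP : (p %| P)%N by apply: dvdn_exp.
have oP : odd P by rewrite oddX; case: (even_prime pp) => [|->]; [lia | rewrite orbT].
have u2 : (2%:R : 'Z_P) \is a GRing.unit by apply: natr_unit_Zp => //; lia.
pose H1 : 'Z_P := \sum_(0 <= t < P | ~~ (p %| t)%N && (2 * t < P)%N) (w t)%:R.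
pose H2 : 'Z_P := \sum_(0 <= t < P | ~~ (p %| t)%N && ~~ (2 * t < P)%N) (w t)%:R.
have HS : H1 + H2 = 0.
  by rewrite -(sum_inv_sqr_mod pp p5 i0 hw) [RHS](bigID (fun t => 2 * t < P)%N).
(* Without the index 0, the range is stable under t -> P - t. *)
have skip0 (Q : pred nat) (F : nat -> 'Z_P) :
    \sum_(0 <= t < P | ~~ (p %| t)%N && Q t) F t =
    \sum_(1 <= t < P | ~~ (p %| t)%N && Q t) F t.
  by rewrite big_ltn_cond ?dvdn0 // ltnW.
have H12 : H1 = H2.
  rewrite /H1 /H2 !skip0 big_nat_rev /=.
  rewrite big_nat_cond [in RHS]big_nat_cond; apply: eq_big => [t|t].
    have [/andP[t0 tP]|] := boolP (1 <= t < P)%N; last by [].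
    rewrite add1n subSS dvdn_subr //; last by lia.
    congr (_ && _); move: oP; clear -t0 tP; lia.
  move=> /andP[/andP[t0 tP] /andP[pt _]].
  move: pt; rewrite add1n subSS => pt.
  have pt' : ~~ (p %| t)%N by move: pt; rewrite dvdn_subr //; lia.
  rewrite !(inv_sqr_modE pp i0 hw) // natrB; last by lia.
  by rewrite pchar_Zp // sub0r sqrrN.
have H10 : H1 = 0.
  by apply: (mulrI u2); rewrite mulr0 mulr_natl mulr2n {2}H12.
have dvdP n : (n%:R = 0 :> 'Z_P) -> (P %| n)%N.
  by move/(Zp_nat_eqP n 0 P1); rewrite mod0n => /eqP.
by split; apply: dvdP; rewrite natr_sum -/H1 -/H2 -?H12.
Qed.

End HalfSums.

(* [w] only depends on [k mod p ^ i], so each half-block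
   [q <= 2 k / p ^ i < q + 1] contributes a multiple of [p ^ i]. *)
Lemma weighted_sum_mod p i d w f g a : prime p -> 5 <= p -> 0 < i ->
  inv_sqr_mod p (p ^ i) w ->
  (forall j, f j = g j %[mod d]) ->
  \sum_(0 <= k < a * p ^ i | ~~ (p %| k)) f (2 * k %/ p ^ i) * w k =
  \sum_(0 <= k < a * p ^ i | ~~ (p %| k)) g (2 * k %/ p ^ i) * w k %[mod d * p ^ i].
Proof.
move=> pp p5 i0 hw fg; set P := p ^ i.
have P0 : 0 < P by rewrite expn_gt0 prime_gt0.
have pP : p %| P by apply: dvdn_exp.
have P1 : 1 < P by rewrite -(exp1n i) ltn_exp2r // prime_gt1.
have [S1 S2] := half_sum_inv_sqr_mod pp p5 i0 hw.
rewrite ![in X in X = _ %[mod _]]big_mkcond ![in X in _ = X %[mod _]]big_mkcond !big_nat_mul.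
apply: eqn_mod_sum => c _.
have shift (F : nat -> nat) : \sum_(c * P <= k < c.+1 * P) F k = \sum_(0 <= t < P) F (c * P + t).
  rewrite -{1}[c * P]add0n big_addn mulSn addnK.
  by apply: eq_bigr => t _; rewrite addnC.
have wper t : ~~ (p %| t) -> w (c * P + t) = w t %[mod P].
  move=> pt; apply/Zp_nat_eqP => //.
  rewrite !(inv_sqr_modE pp i0 hw) //; last by rewrite dvdn_addr // dvdn_mull.
  by rewrite GRing.natrD GRing.natrM pchar_Zp // GRing.mulr0 GRing.add0r.
pose H (h : nat -> nat) (Q : pred nat) q :=
  h q * \sum_(0 <= t < P | ~~ (p %| t) && Q t) w (c * P + t).
(* For k = cP + t with t < P, floor(2k / P) is 2c if 2t < P and 2c + 1 otherwise. *)
have split h : \sum_(0 <= t < P)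
    (if ~~ (p %| c * P + t) then h (2 * (c * P + t) %/ P) * w (c * P + t) else 0) =
    H h (fun t => 2 * t < P) (2 * c) + H h (fun t => ~~ (2 * t < P)) (2 * c).+1.
  rewrite -big_mkcond (bigID (fun t => 2 * t < P)) /H !big_distrr /=.
  congr (_ + _); rewrite big_nat_cond [in RHS]big_nat_cond; apply: eq_big => t;
    rewrite ?[p %| _ + t]dvdn_addr ?dvdn_mull // => /andP[/andP[_ tP] /andP[_ th]].
    by rewrite mulnDr mulnA divnMDl // divn_small // addn0.
  congr (h _ * _); rewrite mulnDr mulnA divnMDl //.
  have -> : 2 * t = 1 * P + (2 * t - P) by lia.
  by rewrite divnMDl // divn_small; lia.
have dvdH Q : P %| \sum_(0 <= t < P | ~~ (p %| t) && Q t) w t ->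
    P %| \sum_(0 <= t < P | ~~ (p %| t) && Q t) w (c * P + t).
  rewrite /dvdn => /eqP e; apply/eqP; rewrite -[RHS]e.
  by apply: eqn_mod_sum => t /andP[pt _]; apply: wper.
by rewrite !shift !split -modnDm /H !(eqn_mod_scale (fg _)) ?modnDm //; apply: dvdH.
Qed.

(** * A Jacobsthal-type congruence *)

Section ProdCopMod.
Local Open Scope ring_scope.
Import GRing.Theory.

Lemma prod_cop_sqr p x y : (p %| y)%N ->
  (prod_cop p x y ^ 2 =
   \prod_(1 <= j < y | ~~ (p %| j)) (j * (y - j) + x * (x + y)))%N.
Proof.
(* The end j = y drops out because p divides y, so j -> y - j permutes the indices. *)
move=> py; have -> : prod_cop p x y = (\prod_(1 <= j < y | ~~ (p %| j)) (x + j))%N.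
  rewrite /prod_cop; case: y py => [|y] py; first by rewrite !big_geq.
  by rewrite (big_mkcond (fun j => ~~ _)) big_nat_recr //= py muln1 -big_mkcond.
have rev : (\prod_(1 <= j < y | ~~ (p %| j)) (x + j) =
            \prod_(1 <= j < y | ~~ (p %| j)) (x + (y - j)))%N.
  rewrite big_nat_rev /= big_nat_cond [RHS]big_nat_cond.
  apply: eq_big => j; rewrite add1n subSS //.
  by have [/andP[j1 jy]|//] := boolP (1 <= j < y)%N; rewrite dvdn_subr // ltnW.
rewrite -mulnn {2}rev -big_split /= big_nat_cond [RHS]big_nat_cond.
apply: eq_bigr => j /andP[/andP[j1 jy] _].
by have := subnKC (ltnW jy); move: (y - j)%N => z <-; ring.
Qed.

Lemma prod_1BM (R : comNzRingType) (I : Type) (s : seq I) (P : pred I) (F : I -> R) (X : R) :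
  X * X = 0 -> \prod_(i <- s | P i) (1 - X * F i) = 1 - X * \sum_(i <- s | P i) F i.
Proof.
move=> X0; elim/big_rec2: _ => [|i a b _ ->]; first by rewrite mulr0 subr0.
transitivity (1 - X * (F i + a) + X * X * (F i * a)); first by ring.
by rewrite X0 mul0r addr0.
Qed.

(* Pairing j with y - j turns the square of the product into
   prod (u_j + X) with X = x (x + y) and u_j = j (y - j); modulo M both X^2
   and X y vanish, so the product changes by the factor 1 - X sum 1/j^2. *)
Lemma prod_cop_mod p r t x y : prime p -> (5 <= p)%N -> (0 < t <= r)%N ->
  (p ^ t %| x)%N -> (p ^ t %| y)%N -> (p ^ (r + t) %| x * (x + y))%N ->
  prod_cop p x y = prod_cop p 0 y %[mod p ^ (r + 2 * t)].
Proof.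
move=> pp p5 /andP[t0 tr] px py pX; set M := (p ^ (r + 2 * t))%N.
have n0 : (0 < r + 2 * t)%N by lia.
have M1 : (1 < M)%N by rewrite -(exp1n (r + 2 * t)) ltn_exp2r // prime_gt1.
have p1x : (p %| x)%N by apply: dvdn_trans px; apply: dvdn_exp.
have p1y : (p %| y)%N by apply: dvdn_trans py; apply: dvdn_exp.
have [w hw] := inv_sqr_mod_exists (r + 2 * t) pp.
have hwt : inv_sqr_mod p (p ^ t) w.
  by move=> k /hw; apply: eqn_mod_dvdl; apply: dvdn_exp2l; lia.
have sw : (p ^ t %| \sum_(1 <= j < y | ~~ (p %| j)) w j)%N.
  case: y py {pX p1y} => [|y] py; first by rewrite big_geq.
  (* Modulo d = 1 the constants 1 and 0 agree, so the sum of the weights over whole blocks vanishes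
     modulo p^t. *)
  have /= := @weighted_sum_mod p t 1 w (fun=> 1%N) (fun=> 0%N) (y.+1 %/ p ^ t) pp p5 t0 hwt.
  rewrite mul1n divnK // => /(_ (fun j => etrans (modn1 _) (esym (modn1 _)))).
  rewrite [in X in _ = X -> _]big1 // mod0n big_ltn_cond ?dvdn0 //= => /eqP.
  by rewrite /dvdn; under eq_bigr do rewrite mul1n.
have M0 n : (M %| n)%N -> n%:R = 0 :> 'Z_M.
  by move=> h; apply/(Zp_nat_eqP n 0 M1); rewrite mod0n; apply/eqP.
pose X : 'Z_M := (x * (x + y))%:R.
have pM : (M = p ^ (r + t) * p ^ t)%N by rewrite -expnD; congr (_ ^ _)%N; lia.
have XX : X * X = 0.
  rewrite -natrM M0 // pM dvdn_mul // (dvdn_trans _ pX) // dvdn_exp2l //; lia.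
have Xy : X * y%:R = 0 by rewrite -natrM M0 // pM dvdn_mul.
have Xw : X * \sum_(1 <= j < y | ~~ (p %| j)%N) (w j)%:R = 0.
  by rewrite -natr_sum -natrM M0 // pM dvdn_mul.
set V := prod_cop p x y; set U := prod_cop p 0 y.
have VU2 : (V%:R ^+ 2 = U%:R ^+ 2 :> 'Z_M).
  rewrite -!natrX /V /U !prod_cop_sqr // !natr_prod /=.
  (* Factor by factor, j (y - j) X w(j) = -X, since X y = 0 and j^2 w(j) = 1. *)
  transitivity (\prod_(1 <= j < y | ~~ (p %| j)%N)
     ((j * (y - j) + 0 * (0 + y))%:R * (1 - X * (w j)%:R) : 'Z_M)); last first.
    by rewrite big_split /= prod_1BM // Xw subr0 mulr1.
  rewrite big_nat_cond [RHS]big_nat_cond; apply: eq_bigr => j /andP[/andP[_ jy] pj].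
  have /(Zp_nat_eqP _ _ M1) := hw j pj; rewrite natrM natrX => jw.
  rewrite natrD -/X mul0n addn0 natrM natrB; last exact: ltnW.
  transitivity (j%:R * (y%:R - j%:R) + X * (j%:R ^+ 2 * (w j)%:R)
                - (X * y%:R) * (j%:R * (w j)%:R) : 'Z_M); last by ring.
  by rewrite jw Xy mulr1 mul0r subr0.
(* To get V = U from V^2 = U^2, V + U must be a unit: modulo p it is 2U. *)
have VUp : V = U %[mod p].
  by apply: eqn_mod_prod => j _; rewrite -modnDml (eqP p1x).
have cVU : coprime M (V + U).
  rewrite coprime_pexpl // prime_coprime // /dvdn -modnDml VUp modnDml addnn -mul2n.
  rewrite -/(dvdn p _) Euclid_dvdM // negb_or; apply/andP; split.
    by apply/negP => h; have := dvdn_leq (ltn0Sn 1) h; lia.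
  by rewrite -prime_coprime // -[p]expn1 prod_cop_coprime.
apply/(Zp_nat_eqP _ _ M1); apply: subr0_eq.
have u : ((V + U)%:R : 'Z_M) \is a GRing.unit by rewrite unitZpE.
apply: (mulIr u); rewrite mul0r natrD.
by rewrite -subr_sqr VU2 subrr.
Qed.

End ProdCopMod.

(** The ratio of the binomials is V / U. An exact identity with U and V lets a common power of p be
    cancelled from the binomials without weakening the modulus. *)
Lemma bin_mod_mul_prime p r t x y : prime p -> 5 <= p -> 0 < t <= r ->
  p ^ t %| x -> p ^ t %| y -> p ^ (r + t) %| x * (x + y) ->
  exists U V, [/\ coprime p U, V = U %[mod p ^ (r + 2 * t)] &
    'C(x + y, y) * U = 'C(x %/ p + y %/ p, y %/ p) * V].
Proof.
move=> pp p5 tr px py pX; have /andP[t0 _] := tr.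
have p1x : p %| x by apply: dvdn_trans px; apply: dvdn_exp.
exists (prod_cop p 0 y), (prod_cop p x y); split.
- by rewrite -[p in coprime p _]expn1 prod_cop_coprime.
- exact: prod_cop_mod.
- by have := bin_prod_cop (x %/ p) y (prime_gt0 pp); rewrite [p * _]mulnC divnK.
Qed.

(** * Summands with p dividing k *)

Lemma dvdn_mul_bin n k : n %| k * 'C(n, k).
Proof.
by case: k => [|k]; rewrite ?dvdn0 // -mul_bin_diag dvdn_mulr.
Qed.

(** Applied with c a binomial coefficient, to extract its factor p^(r-t). *)
Lemma dvdn_pfactor_gcd p r t k c : 0 < p -> gcdn k (p ^ r) = p ^ t -> t <= r ->
  p ^ r %| k * c -> p ^ (r - t) %| c.
Proof.
move=> p0 kt tr h.
have : p ^ r %| gcdn k (p ^ r) * c by rewrite muln_gcdl dvdn_gcd h dvdn_mulr.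
by rewrite kt -{1}(subnKC tr) expnD dvdn_pmul2l // expn_gt0 p0.
Qed.

Definition summand (A B C n k : nat) : nat :=
  'C(n, k) ^ A * 'C(n + k, k) ^ B * 'C(2 * k, n) ^ C.

(** The congruence for C(x + y, y) is used at (x, y) = (n, k), (n, 2k - n) and (n - k, k). Each time
    x (x + y) is n times a multiple of p^t, whence the exponent r + t. *)
Lemma summand_mul_prime A B C p r n k : prime p -> 5 <= p -> 2 <= A -> 0 < r ->
  p ^ r %| n -> p %| k -> k <= n ->
  summand A B C n k = summand A B C (n %/ p) (k %/ p) %[mod p ^ (3 * r)].
Proof.
move=> pp p5 hA r0 prn pk kn; have p0 := prime_gt0 pp.
have pn : p %| n by apply: dvdn_trans prn; apply: dvdn_exp.
have /(dvdn_pfactor _ _ pp)[t tr kt] := dvdn_gcdr k (p ^ r).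
have t0 : 0 < t.
  rewrite lt0n; apply/eqP => t0; have : p %| gcdn k (p ^ r).
    by rewrite dvdn_gcd pk dvdn_exp.
  by rewrite kt t0 dvdn1 => /eqP p1; rewrite p1 in p5.
have tr' : 0 < t <= r by rewrite t0.
have ptk : p ^ t %| k by rewrite -kt dvdn_gcdl.
have ptn : p ^ t %| n by apply: dvdn_trans prn; apply: dvdn_exp2l.
have cong_bin x y : p ^ t %| x -> p ^ t %| y -> p ^ (r + t) %| x * (x + y) ->
    'C(x + y, y) = 'C((x + y) %/ p, y %/ p) %[mod p ^ (r + 2 * t)].
  move=> px py pX; have [U [V [cU VU e]]] := bin_mod_mul_prime pp p5 tr' px py pX.
  apply: (@eqn_mod_cancel _ U); first by rewrite coprimeXl.
  rewrite e divnDl; last by apply: dvdn_trans px; apply: dvdn_exp.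
  exact: eqn_modM.
have eB : 'C(n + k, k) = 'C(n %/ p + k %/ p, k %/ p) %[mod p ^ (r + 2 * t)].
  rewrite -divnDl // cong_bin // expnD dvdn_mul // dvdn_addr //.
have eC : 'C(2 * k, n) = 'C(2 * (k %/ p), n %/ p) %[mod p ^ (r + 2 * t)].
  rewrite muln_divA //.
  have [nk|nk] := ltnP (2 * k) n.
    by rewrite !bin_small // ltn_divLR // divnK.
  have e : 2 * k = n + (2 * k - n) by rewrite subnKC.
  have pl : p ^ t %| 2 * k - n by rewrite dvdn_sub // dvdn_mull.
  have pl1 : p %| 2 * k - n by rewrite dvdn_sub // dvdn_mull.
  have := cong_bin n (2 * k - n) ptn pl; rewrite -e bin_sub // => ->; last first.
    by rewrite expnD dvdn_mul // dvdn_mull.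
  by rewrite divnBr // bin_sub // leq_div2r.
have [U [V [cU VU e]]] : exists U V, [/\ coprime p U, V = U %[mod p ^ (r + 2 * t)] &
    'C(n, k) * U = 'C(n %/ p, k %/ p) * V].
  have pl : p ^ t %| n - k by rewrite dvdn_sub.
  have h : p ^ (r + t) %| (n - k) * (n - k + k).
    by rewrite subnK // mulnC expnD dvdn_mul.
  have := bin_mod_mul_prime pp p5 tr' pl ptk h.
  by rewrite -divnDl ?subnK // dvdn_sub.
have /dvdnP[c ec] : p ^ (r - t) %| 'C(n, k).
  by apply: dvdn_pfactor_gcd kt tr _ => //; apply: dvdn_trans prn (dvdn_mul_bin n k).
have /dvdnP[c' ec'] : p ^ (r - t) %| 'C(n %/ p, k %/ p).
  apply: dvdn_pfactor_gcd kt tr _ => //.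
  apply: (dvdn_trans prn); rewrite -{1}(divnK pn) -{1}(divnK pk) mulnAC.
  by rewrite dvdn_pmul2r // dvdn_mul_bin.
have cc : c = c' %[mod p ^ (r + 2 * t)].
  apply: (@eqn_mod_cancel _ U); first by rewrite coprimeXl.
  have -> : c * U = c' * V.
    apply/eqP; rewrite -(eqn_pmul2r (_ : 0 < p ^ (r - t))) ?expn_gt0 ?p0 //.
    by rewrite mulnAC -ec e ec' mulnAC.
  exact: eqn_modM.
rewrite /summand ec ec' !expnMn.
have : c ^ A * 'C(n + k, k) ^ B * 'C(2 * k, n) ^ C =
       c' ^ A * 'C(n %/ p + k %/ p, k %/ p) ^ B * 'C(2 * (k %/ p), n %/ p) ^ C
         %[mod p ^ (r + 2 * t)].
  by do 2?apply: eqn_modM; apply: eqn_modX.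
move/eqn_mod_scale => /(_ _ _ (dvdn_exp2l (p ^ (r - t)) hA)).
rewrite -[(p ^ (r - t)) ^ 2]expnM -expnD.
have -> : r + 2 * t + (r - t) * 2 = 3 * r by clear -tr; lia.
have ac x y z u : x * y * z * u = x * z * u * y by ring.
by rewrite [in X in _ -> X = _]ac [in X in _ -> _ = X]ac.
Qed.

(** * Summands with k prime to p *)

Lemma half_divn p k : 2 * k %/ p %/ 2 = k %/ p.
Proof. by rewrite divnAC mulKn. Qed.

(* [j] plays the role of 2k: passing from (n, 2k) to (n/p, floor(2k/p)). *)
Definition reduced_summand (B C n j : nat) : nat :=
  'C(n.-1, j %/ 2) ^ 2 * 'C(n + j %/ 2, j %/ 2) ^ B * 'C(j, n) ^ C.

Lemma reduced_summand_mod_floor B C p r n j : prime p -> p ^ r %| n -> 0 < r -> 0 < n ->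
  reduced_summand B C n j = reduced_summand B C (n %/ p) (j %/ p) %[mod p ^ r].
Proof.
move=> pp prn r0 n0; rewrite /reduced_summand divnAC.
do 2?apply: eqn_modM; [exact: bin_pred_sqr_mod_floor | |]; apply: eqn_modX.
  exact: bin_add_mod_floor.
exact: bin_mod_floor.
Qed.

Lemma sum_reduced_summand B C p r m w : prime p -> 5 <= p -> 0 < r -> 0 < m ->
  inv_sqr_mod p (p ^ r) w ->
  p ^ r %| \sum_(0 <= k < m * p ^ r | ~~ (p %| k))
             reduced_summand B C (m * p ^ r.-1) (2 * k %/ p) * w k.
Proof.
move=> pp p5 r0 m0 hw.
(* [T 1] is the sum in question. From [T i] to [T i.+1] the coefficients change by multiples of
   p^(r-i), and the half-block sums supply p^i. *)
pose T i := \sum_(0 <= k < m * p ^ r | ~~ (p %| k))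
              reduced_summand B C (m * p ^ (r - i)) (2 * k %/ p ^ i) * w k.
have p0 := prime_gt0 pp.
have hwi i : i <= r -> inv_sqr_mod p (p ^ i) w.
  by move=> ir k /hw; apply: eqn_mod_dvdl; apply: dvdn_exp2l.
have step i : 0 < i < r -> T i = T i.+1 %[mod p ^ r].
  move=> /andP[i0 ir]; rewrite /T.
  have := @weighted_sum_mod p i (p ^ (r - i)) w (reduced_summand B C (m * p ^ (r - i)))
    (fun j => reduced_summand B C (m * p ^ (r - i.+1)) (j %/ p)) (m * p ^ (r - i))
    pp p5 i0 (hwi i (ltnW ir)).
  rewrite -mulnA -expnD subnK ?(ltnW ir) // => ->.
    by under eq_bigr do rewrite -divnMA -expnSr.
  move=> j; rewrite reduced_summand_mod_floor ?dvdn_mull ?subn_gt0 ?muln_gt0 ?m0 ?expn_gt0 ?p0 //.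
  by rewrite -[X in p ^ X]prednK ?subn_gt0 // -subnS expnSr mulnA mulnK.
have T1 i : 0 < i <= r -> T 1 = T i %[mod p ^ r].
  elim: i => [|[|i] IH] // /andP[_ ir].
  by rewrite IH ?(ltnW ir) // step.
(* At level r the half-block sums alone supply p^r, so the coefficients may be replaced by 0. *)
have Tr : T r = 0 %[mod p ^ r].
  have := @weighted_sum_mod p r 1 w (reduced_summand B C m) (fun=> 0) m pp p5 r0 hw.
  rewrite mul1n /T subnn muln1 => -> => [|j]; last by rewrite !modn1.
  by rewrite big1.
have := T1 r; rewrite r0 leqnn Tr mod0n => /(_ isT) /eqP.
by rewrite /T subn1 expn1.
Qed.

Lemma sum_summand_coprime A B C p r m : prime p -> 5 <= p -> 2 <= A -> 0 < r -> 0 < m ->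
  p ^ (3 * r) %| \sum_(0 <= k < m * p ^ r | ~~ (p %| k)) summand A B C (m * p ^ r) k.
Proof.
move=> pp p5 hA r0 m0; set n := m * p ^ r; have p0 := prime_gt0 pp.
have n0 : 0 < n by rewrite muln_gt0 m0 expn_gt0 p0.
have prn : p ^ r %| n by rewrite dvdn_mull.
have pn : p %| n by apply: dvdn_trans prn; apply: dvdn_exp.
have dC k : ~~ (p %| k) -> p ^ r %| 'C(n, k).
  move=> pk; rewrite -(@Gauss_dvdr _ k) ?coprime_pexpl ?prime_coprime //.
  exact: dvdn_trans prn (dvdn_mul_bin n k).
(* For A >= 3 the power of C(n, k) already contains p^(3r). *)
have [A3|A2] := ltnP 2 A.
  apply: dvdn_sum => k pk; rewrite /summand -mulnA dvdn_mulr //.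
  by rewrite mulnC expnM (dvdn_trans (dvdn_exp2l _ A3)) // dvdn_exp2r // dC.
have {hA A2 A} -> : A = 2 by lia.
have [w hw] := inv_sqr_mod_exists r pp.
have term k : ~~ (p %| k) -> summand 2 B C n k =
    p ^ (2 * r) * (m ^ 2 * (reduced_summand B C (m * p ^ r.-1) (2 * k %/ p) * w k))
      %[mod p ^ (3 * r)].
  move=> pk; case: k pk => [|k] pk; first by rewrite dvdn0 in pk.
  have enp : n %/ p = m * p ^ r.-1.
    by rewrite /n -[in p ^ r](prednK r0) expnSr mulnA mulnK.
  have /dvdnP[c ec] := dC _ pk.
  have ekc : k.+1 * c = m * 'C(n.-1, k).
    apply/eqP; rewrite -(@eqn_pmul2r (p ^ r)) ?expn_gt0 ?p0 // -mulnA -ec.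
    by rewrite -mul_bin_diag mulnAC.
  (* This turns the lower index [k] of C(n - 1, k) into the floor of [k.+1] over p that
     [reduced_summand] expects. *)
  have efl : k %/ p = k.+1 %/ p by rewrite divnS // (negbTE pk).
  have cw : c ^ 2 = m ^ 2 * ('C((n %/ p).-1, k.+1 %/ p) ^ 2 * w k.+1) %[mod p ^ r].
    rewrite mulnA -efl.
    have -> : c ^ 2 = c ^ 2 * (k.+1 ^ 2 * w k.+1) %[mod p ^ r].
      by rewrite -[in LHS](muln1 (c ^ 2)); apply: eqn_modM => //; rewrite hw.
    rewrite mulnA -expnMn [c * _]mulnC ekc expnMn.
    by do 2?apply: eqn_modM => //; apply: bin_pred_sqr_mod_floor.
  have h : c ^ 2 * 'C(n + k.+1, k.+1) ^ B * 'C(2 * k.+1, n) ^ C =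
    m ^ 2 * (reduced_summand B C (n %/ p) (2 * k.+1 %/ p) * w k.+1) %[mod p ^ r].
    rewrite /reduced_summand half_divn.
    transitivity ((m ^ 2 * ('C((n %/ p).-1, k.+1 %/ p) ^ 2 * w k.+1)) *
      'C(n %/ p + k.+1 %/ p, k.+1 %/ p) ^ B * 'C(2 * k.+1 %/ p, n %/ p) ^ C %% p ^ r).
      do 2?apply: eqn_modM => //; apply: eqn_modX.
        exact: bin_add_mod_floor.
      exact: bin_mod_floor.
    by congr (_ %% _); ring.
  have := eqn_mod_scale h (dvdnn (p ^ (2 * r))).
  rewrite -expnD (_ : r + 2 * r = 3 * r); last by clear; lia.
  rewrite -enp [p ^ (2 * r) * _]mulnC => <-; congr (_ %% _).
  rewrite /summand ec expnMn -expnM [r * 2]mulnC; ring.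
rewrite /dvdn (eqn_mod_sum _ term) -!big_distrr /= -/(dvdn _ _).
have -> : 3 * r = 2 * r + r by lia.
by rewrite expnD dvdn_mul // dvdn_mull // sum_reduced_summand.
Qed.

(** * Matching the two sums *)

Theorem theorem1p2 (A B C : nat) (hA : 2 <= A)
    (m r p : nat) (hm : 1 <= m) (hr : 1 <= r) (hp : prime p) (hp5 : 5 <= p) :
  calS (m * p ^ r) A B C = calS (m * p ^ (r - 1)) A B C %[mod p ^ (3 * r)].
Proof.
have p0 := prime_gt0 hp; set n := m * p ^ r.
have prn : p ^ r %| n by rewrite dvdn_mull.
have pn : p %| n by apply: dvdn_trans prn; apply: dvdn_exp.
have en : n = m * p ^ (r - 1) * p by rewrite -mulnA -expnSr subn1 prednK.
set n1 := m * p ^ (r - 1) in en *.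
have sumE N : calS N A B C = \sum_(0 <= k < N.+1) summand A B C N k by [].
rewrite !{}sumE.
(* The top index k = n is split off, so that the range k < n consists of n/p full blocks of length
   p, each with one multiple of p, its first element. *)
rewrite big_nat_recr //= (bigID (fun k => p %| k)) /=.
rewrite addnAC -modnDm (eqP (sum_summand_coprime B C hp hp5 hA hr hm)) addn0 modn_mod.
rewrite [in RHS]big_nat_recr //=.
rewrite -modnDm -[in RHS]modnDm; congr ((_ + _) %% _); last first.
  have := summand_mul_prime B C hp hp5 hA hr prn pn (leqnn n).
  by rewrite en mulnK.
rewrite big_mkcond [in X in \sum_(0 <= _ < X) _]en big_nat_mul.
rewrite big_nat_cond [in RHS]big_nat_cond; apply: eqn_mod_sum => c /andP[/andP[_ cn] _].
rewrite big_ltn ?ltn_pmul2r // dvdn_mull //= big1_seq ?addn0 => [|j].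
  have cpn : c * p <= n by rewrite en leq_pmul2r // ltnW.
  have := summand_mul_prime B C hp hp5 hA hr prn (dvdn_mull c (dvdnn p)) cpn.
  by rewrite en !mulnK.
rewrite mem_index_iota => /andP[_ /andP[cj jc]]; case: ifP => // /dvdnP[d ej].
by move: cj jc; rewrite ej !ltn_pmul2r // ltnS ltnNge => /negbTE->.
Qed.
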